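(* If a Banach space $G$ is of universal disposition for finite-dimensional spaces, then the density character of $G$ (the least cardinality of a norm-dense subset) is at least the continuum.
   Context: All spaces are real. A Banach space $G$ is of universal disposition for finite-dimensional spaces if for any finite-dimensional Banach spaces $E \subseteq F$ (isometric inclusion) and any linear isometric embedding $\varphi \colon E \to G$ there is a linear isometric embedding $\psi \colon F \to G$ extending $\varphi$. *)

(* Defs.v *)
From HB Require Import structures.
From mathcomp Require Import all_boot all_order all_algebra.
From mathcomp Require Import all_classical all_reals all_analysis.

Set Implicit Arguments.
Unset Strict Implicit.
Unset Printing Implicit Defensive.

Import Order.TTheory GRing.Theory Num.Theory.
Import numFieldNormedType.Exports.

Local Open Scope classical_set_scope.
Local Open Scope ring_scope.
Local Open Scope card_scope.

(* The choice functions in X below form a maximal family that is injective at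
   every member of P; maximality makes it surjective onto some member. *)
Lemma ex_least_card (T : Type) (P : set (set T)) :
  P !=set0 -> exists A, P A /\ forall B, P B -> A #<= B.
Proof.
move=> [A0 PA0].
pose Q : set (set (set T -> T)) := [set X |
  (forall f, X f -> forall B, P B -> B (f B)) /\
  (forall f g, X f -> X g -> forall B, P B -> f B = g B -> f = g)].
have [F FQ Ftot|X [[XB Xinj] Xmax]] := @Zorn_bigcup _ Q.
  split=> [f [Y FY Yf] B PB|f g [Y FY Yf] [Z FZ Zg] B PB fgB].
    exact: (FQ _ FY).1 Yf B PB.
  have [YZ|ZY] := Ftot _ _ FY FZ.
    exact: (FQ _ FZ).2 (YZ _ Yf) Zg B PB fgB.
  exact: (FQ _ FY).2 Yf (ZY _ Zg) B PB fgB.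
have [[A [PA XA]]|noA] := pselect (exists A, P A /\
    A `<=` [set f A | f in X]).
  exists A; split=> // B PB.
  have AX : A #<= X.
    exact: card_le_trans (subset_card_le XA) (card_image_le _ _).
  have BX : [set f B | f in X] `<=` B by move=> _ [f Xf <-]; exact: XB Xf B PB.
  have : [set f B | f in X] #= X.
    apply: inj_card_eq => f g /set_mem Xf /set_mem Xg.
    exact: Xinj Xf Xg B PB.
  move=> /card_eqPle[_ XXB].
  exact: card_le_trans AX (card_le_trans XXB (subset_card_le BX)).
have new B : P B -> exists b, B b /\ forall f, X f -> f B <> b.
  move=> PB; apply: contrapT => nb; apply: noA; exists B; split=> // b Bb.
  apply: contrapT => Xb; apply: nb; exists b; split=> // f Xf fb.
  by apply: Xb; exists f.
have [b0 _] := new _ PA0.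
have /choice[h hP] : forall B, exists b, P B ->
    B b /\ forall f, X f -> f B <> b.
  move=> B; have [/new[b ?]|?] := pselect (P B); first by exists b.
  by exists b0.
exfalso; apply: (Xmax (X `|` [set h])); first split.
- by move=> f Xf; left.
- by move=> /(_ h (or_intror erefl)) Xh; apply: (hP _ PA0).2 Xh _.
split=> [f [Xf|->] B PB|f g [Xf|->] [Xg|->] B PB //].
- exact: XB Xf B PB.
- exact: (hP _ PB).1.
- exact: Xinj Xf Xg B PB.
- by move/((hP _ PB).2 _ Xf).
- by move/esym/((hP _ PB).2 _ Xg).
Qed.

Lemma ex_least_card_dense (T : topologicalType) :
  exists A : set T, dense A /\ forall B : set T, dense B -> A #<= B.
Proof.
apply: (@ex_least_card T (@dense T)); exists setT => O O0 _.
by rewrite setIT.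
Qed.

(* A cardinal is represented by a set having it: density_character T is a
   dense set of least cardinality, to be compared by #<= and #=. *)
Definition density_character (T : topologicalType) : set T :=
  sval (cid (ex_least_card_dense T)).
Arguments density_character : clear implicits.

Lemma density_characterP (T : topologicalType) :
  dense (density_character T) /\
  forall B : set T, dense B -> density_character T #<= B.
Proof. exact: svalP (cid (ex_least_card_dense T)). Qed.

Definition finite_dimensional (R : realType) (V : lmodType R) : Prop :=
  exists (n : nat) (b : 'I_n -> V), forall x : V,
    exists c : 'I_n -> R, x = \sum_(i < n) c i *: b i.

Definition isometric (R : realType) (V W : normedModType R) (f : V -> W) :
  Prop := forall x : V, `|f x| = `|x|.

(* The isometric inclusion of E in F is given as a map i, so that "psi extends
   phi" reads psi \o i = phi. *)
Definition universal_disposition (R : realType)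
    (G : completeNormedModType R) : Prop :=
  forall (E F : completeNormedModType R)
    (i : {linear E -> F}) (phi : {linear E -> G}),
    finite_dimensional E -> finite_dimensional F ->
    isometric i -> isometric phi ->
    exists psi : {linear F -> G},
      isometric psi /\ forall x : E, psi (i x) = phi x.

(* Main.v *)
Require Import Defs.
From mathcomp Require Import all_boot all_order all_algebra.
From mathcomp Require Import all_classical all_reals all_analysis.
From HB Require Import structures.
From mathcomp Require Import ring lra.
Import Order.TTheory GRing.Theory Num.Theory.
Import numFieldNormedType.Exports.

Local Open Scope classical_set_scope.
Local Open Scope ring_scope.
Local Open Scope card_scope.

(** The space [G] contains [1]-separated points [x_t], one for each real [t];
    a dense set has to meet the disjoint balls of radius [1/2] around them,
    hence is at least as large as [R].

    A single finite-dimensional subspace [E] of [G] already forces these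
    points. Let [E] be the Euclidean plane,
    embedded in [G] by extending the zero map from the zero space. For a unit
    vector [u] of [E], let [F_u] be [E + R] with the norm
      [max(|a|, |<a, u> + l|, |l|)].
    As [|<a, u>| <= |a|], this restricts to the norm of [E], so universal
    disposition yields a point [x_u] of [G] with
      [|a + x_u| = max(|a|, |<a, u> + 1|, 1)] for all [a] in [E]
    (lemma [universal_disposition_point]). On the ray spanned by [u], the
    distance from [-r u] to [x_u] is [r + 1]. If [v] is another unit vector,
    strict convexity gives [<u, v> < 1], so that for large [r] the
    distance from [-r u] to [x_v] is only [r]. The triangle inequality then gives
    [|x_u - x_v| >= 1] (lemma [separated_points]). What matters about the
    Euclidean plane is that each of its continuum many unit vectors is exposed
    by its own norm-one functional; the rational parametrization of the
    circle indexes them by the reals.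

    Universal disposition quantifies over Banach spaces, so the norms above
    have to be turned into complete normed modules. This is done once for all
    norms on row vectors that dominate the coordinates. *)

(** * Row vectors under an arbitrary norm *)

(** For a norm on a finite-dimensional space, domination of the coordinates
    holds up to a constant. Requiring it with constant [1] costs nothing for
    the norms needed here; it gives definiteness, and it makes
    completeness a matter of coordinates. *)
Record row_norm (R : realType) (n : nat) := RowNorm {
  row_norm_fun :> 'rV[R]_n -> R;
  row_normD : forall x y,
    row_norm_fun (x + y) <= row_norm_fun x + row_norm_fun y;
  row_normZ : forall k x, row_norm_fun (k *: x) = `|k| * row_norm_fun x;
  row_norm_coord : forall (x : 'rV[R]_n) j, `|x 0 j| <= row_norm_fun x }.

Lemma row_norm_eq0 (R : realType) (n : nat) (N : row_norm R n) x :
  N x = 0 -> x = 0.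
Proof.
move=> Nx0; apply/rowP => j; apply/eqP.
by rewrite mxE -normr_le0 -Nx0 row_norm_coord.
Qed.

(** An alias of the row vectors on which the norm [N] can replace the
    supremum norm that they carry canonically. *)
Definition renormed (R : realType) (n : nat) (N : row_norm R n) : Type :=
  'rV[R]_n.

HB.instance Definition _ (R : realType) (n : nat) (N : row_norm R n) :=
  GRing.Lmodule.copy (renormed R n N) 'rV[R]_n.

HB.instance Definition _ (R : realType) (n : nat) (N : row_norm R n) :=
  Lmodule_isNormed.Build R (renormed R n N)
    (row_normD _ _ N) (row_normZ _ _ N) (row_norm_eq0 _ _ N).

Lemma renormedE (R : realType) (n : nat) (N : row_norm R n)
  (x : renormed R n N) : `|x| = N x.
Proof. by []. Qed.

(** Conversely, [N] is dominated by the coordinates, since it is subadditive on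
    the expansion of a vector in the standard basis. *)
Lemma renormed_le_coord (R : realType) (n : nat) (N : row_norm R n)
    (x : renormed R n N) (e : R) :
  (forall j, `|(x : 'rV[R]_n) 0 j| <= e) ->
  `|x| <= e * \sum_j `|'e_j : renormed R n N|.
Proof.
move=> xe; rewrite [X in `|X|](row_sum_delta (x : 'rV[R]_n)).
apply: (le_trans (ler_norm_sum _ _ _)).
rewrite mulr_sumr; apply: ler_sum => j _.
rewrite [leLHS]row_normZ; apply: ler_wpM2r (xe j).
exact: (normr_ge0 ('e_j : renormed R n N)).
Qed.

(** [N] and the supremum norm dominate each other up to constants, so Cauchy
    filters and their limits are the same for both. *)
Lemma renormed_complete (R : realType) (n : nat) (N : row_norm R n)
    (F : set_system (renormed R n N)) :
  ProperFilter F -> cauchy F -> cvg F.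
Proof.
move=> FF /cauchyP Fc.
have FM : ProperFilter (F : set_system 'rV[R]_n) := FF.
have : cvg (F : set_system 'rV[R]_n).
  apply: cauchy_cvg; apply: cauchy_exP => e e0.
  have [x Fx] := Fc e e0; exists x.
  apply: (@filterS _ F FF _ _ _ Fx) => y; rewrite -ball_normE /= => xy; split=> // i j.
  rewrite ord1 -ball_normE /=; apply: le_lt_trans xy.
  by have := row_norm_coord _ _ N (x - y) j; rewrite !mxE.
move=> /cvg_ex[l Fl]; apply/cvg_ex; exists l.
apply/(@fcvgrPdist_lt _ (renormed R n N) F FF l) => e e0.
pose S := \sum_j `|'e_j : renormed R n N|.
(* [S] vanishes when [n = 0], hence the division by [S + 1]. *)
have S0 : 0 < S + 1 by rewrite ltr_wpDl// sumr_ge0.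
have d0 : 0 < e / (S + 1) by rewrite divr_gt0.
have Fd : F (ball (l : 'rV[R]_n) (e / (S + 1))) by apply: Fl; exact: nbhsx_ballx.
apply: (@filterS _ F FF _ _ _ Fd) => y ly.
have : `|(l : renormed R n N) - y| <= e / (S + 1) * S.
  apply: renormed_le_coord => j; rewrite !mxE ltW//.
  by have := ly.2 0 j; rewrite -ball_normE.
move=> /le_lt_trans; apply.
by rewrite mulrAC ltr_pdivrMr// ltr_pM2l// ltrDl.
Qed.

HB.instance Definition _ (R : realType) (n : nat) (N : row_norm R n) :=
  Uniform_isComplete.Build (renormed R n N) (renormed_complete R n N).

Lemma renormed_finite_dimensional (R : realType) (n : nat)
  (N : row_norm R n) : finite_dimensional (renormed R n N).
Proof.
exists n, (fun j => 'e_j) => x; exists (fun j => (x : 'rV[R]_n) 0 j).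
exact: row_sum_delta.
Qed.

(** * Adjoining a vector that exposes a functional *)

Section one_point_extension.
Context (R : realType) (n : nat) (N : row_norm R n) (c : 'cV[R]_n).

(** The middle term is the value at [x] of the functional that extends [c] and
    maps the new basis vector to [1]; it makes the norm grow at full speed
    along a direction where [c] attains its norm. The last term only ensures
    that the new coordinate is dominated. *)
Definition extension_norm_fun (x : 'rV[R]_(n + 1)) : R :=
  Num.max (N (lsubmx x))
    (Num.max `|(lsubmx x *m c + rsubmx x) 0 0| `|rsubmx x 0 0|).

Lemma extension_normD x y : extension_norm_fun (x + y) <=
  extension_norm_fun x + extension_norm_fun y.
Proof.
rewrite /extension_norm_fun !ge_max; apply/and3P; split.
- by rewrite linearD (le_trans (row_normD _ _ N _ _))// lerD// le_max lexx.
- rewrite !linearD mulmxDl addrACA mxE (le_trans (ler_normD _ _))//.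
  by rewrite lerD// !le_max lexx orbT.
- rewrite linearD mxE (le_trans (ler_normD _ _))//.
  by rewrite lerD// !le_max lexx !orbT.
Qed.

Lemma extension_normZ k x :
  extension_norm_fun (k *: x) = `|k| * extension_norm_fun x.
Proof.
rewrite /extension_norm_fun !maxr_pMr// !linearZ/= -scalemxAl -scalerDr.
by rewrite row_normZ !mxE !normrM.
Qed.

Lemma extension_norm_coord (x : 'rV[R]_(n + 1)) j : `|x 0 j| <= extension_norm_fun x.
Proof.
rewrite -[x]hsubmxK /extension_norm_fun row_mxKl row_mxKr.
case: (split_ordP j) => k ->.
  by rewrite row_mxEl le_max row_norm_coord.
by rewrite row_mxEr !le_max (ord1 k) lexx !orbT.
Qed.

Definition extension_norm : row_norm R (n + 1) :=
  RowNorm _ _ _ extension_normD extension_normZ extension_norm_coord.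

Definition extension_inclusion (a : renormed R n N) :
  renormed R (n + 1) extension_norm := row_mx a (0 : 'rV[R]_1).

Lemma extension_inclusion_linear : linear extension_inclusion.
Proof.
move=> k a b.
have : row_mx (k *: (a : 'rV_n) + b) (0 : 'rV_1) =
    k *: row_mx (a : 'rV_n) (0 : 'rV_1) + row_mx (b : 'rV_n) (0 : 'rV_1).
  by rewrite scale_row_mx add_row_mx scaler0 addr0.
exact.
Qed.

HB.instance Definition _ := GRing.isLinear.Build R (renormed R n N)
  (renormed R (n + 1) extension_norm) _ extension_inclusion
  extension_inclusion_linear.

Lemma extension_inclusion_isometric :
  (forall a, `|(a *m c) 0 0| <= N a) -> isometric extension_inclusion.
Proof.
move=> cN a; rewrite !renormedE /= /extension_norm_fun /extension_inclusion.
rewrite row_mxKl row_mxKr addr0 [in `|(0 : 'rV_1) 0 0|]mxE normr0.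
by apply/max_l; rewrite ge_max cN (le_trans (normr_ge0 _) (cN a)).
Qed.

End one_point_extension.

(** * Separated points in a space of universal disposition *)

Section universal_disposition_spaces.
Context (R : realType) (G : completeNormedModType R).
Context (hG : universal_disposition G).

Definition null_norm : row_norm R 0.
Proof.
by apply: (RowNorm R 0 (fun=> 0)) => [x y|k x|x []//]; rewrite ?addr0 ?mulr0.
Defined.

(** The zero space embeds both in the given space and in [G]. *)
Lemma universal_disposition_embeds (n : nat) (N : row_norm R n) :
  exists phi : {linear renormed R n N -> G}, isometric phi.
Proof.
have null0 (x : renormed R 0 null_norm) : `|x| = 0 by [].
have iso0 (V : normedModType R) :
    isometric (\0 : {linear renormed R 0 null_norm -> V}).
  by move=> x; rewrite null0 normr0.
have [psi [psi_iso _]] := hG _ _ _ _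
  (renormed_finite_dimensional R 0 null_norm) (renormed_finite_dimensional R n N)
  (iso0 (renormed R n N)) (iso0 G).
by exists psi.
Qed.

Context (n : nat) (N : row_norm R n) (phi : {linear renormed R n N -> G}).
Context (phi_iso : isometric phi).

(** The point is the image of the new basis vector under an extension of [phi]
    to the one-point extension determined by [c]. *)
Lemma universal_disposition_point (c : 'cV[R]_n) :
  (forall a, `|(a *m c) 0 0| <= N a) ->
  exists x : G, forall a : 'rV[R]_n,
    `|phi a + x| = Num.max (N a) (Num.max `|(a *m c) 0 0 + 1| 1).
Proof.
move=> cN.
have [psi [psi_iso psi_ext]] := hG _ _
  (extension_inclusion R n N c) phi (renormed_finite_dimensional _ _ _)
  (renormed_finite_dimensional _ _ _)
  (extension_inclusion_isometric R n N c cN) phi_iso.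
exists (psi (row_mx (0 : 'rV[R]_n) (1%:M : 'rV[R]_1))) => a.
have ->: phi a + psi (row_mx (0 : 'rV[R]_n) (1%:M : 'rV[R]_1)) =
    psi (row_mx a (1%:M : 'rV[R]_1)).
  rewrite -psi_ext -raddfD; congr (psi _).
  have : row_mx a (0 : 'rV_1) + row_mx (0 : 'rV_n) (1%:M : 'rV_1) =
      row_mx a (1%:M : 'rV_1) by rewrite add_row_mx addr0 add0r.
  exact.
rewrite psi_iso renormedE /= /extension_norm_fun row_mxKl row_mxKr.
have one00 : (1%:M : 'M[R]_1) 0 0 = 1 by rewrite mxE.
by rewrite [(_ *m c + _) _ _]mxE one00 normr1.
Qed.

(** The vectors [x] and [y] have distances to [- phi (r *: u)] that differ by at
    least [1] as soon as [r] is large, because [c] takes the value [1] at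
    the unit vector [u] and [d] stays below it. *)
Lemma separated_points (c d : 'cV[R]_n) (u : 'rV[R]_n) (x y : G) :
  (forall a : 'rV[R]_n,
    `|phi a + x| = Num.max (N a) (Num.max `|(a *m c) 0 0 + 1| 1)) ->
  (forall a : 'rV[R]_n,
    `|phi a + y| = Num.max (N a) (Num.max `|(a *m d) 0 0 + 1| 1)) ->
  N u = 1 -> (u *m c) 0 0 = 1 -> `|(u *m d) 0 0| <= 1 -> (u *m d) 0 0 < 1 ->
  1 <= `|x - y|.
Proof.
move=> xE yE Nu uc ud1; set q := (u *m d) 0 0 => ud.
(* The distances are [r + 1] and [max(r, |r q + 1|, 1)]; the latter is [r] once
   [r >= 1] and [r (1 - q) >= 1]. *)
pose r := 1 + (1 - q)^-1.
have s0 : 0 < 1 - q by rewrite subr_gt0.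
have r1 : 1 <= r by rewrite lerDl invr_ge0 ltW.
have r0 : 0 <= r by rewrite (le_trans _ r1).
have rq : r * q + 1 <= r.
  rewrite -subr_ge0 (_ : _ - _ = r * (1 - q) - 1); last by ring.
  by rewrite mulrDl mul1r mulVf ?gt_eqF// addrK ltW.
have rx : r + 1 <= `|phi (r *: u) + x|.
  by rewrite xE -scalemxAl mxE uc mulr1 !le_max ler_norm orbT.
have ry : `|phi (r *: u) + y| <= r.
  rewrite yE row_normZ Nu mulr1 -scalemxAl mxE -/q !ge_max r1 ger0_norm// lexx.
  rewrite andbT/= ler_norml rq andbT.
  by move: ud1; rewrite ler_norml -/q => /andP[? _]; nra.
have := ler_normD (x - y) (phi (r *: u) + y).
rewrite addrCA subrK => xy.
by rewrite -(lerD2l r) (le_trans rx)// (le_trans xy)// addrC lerD2r.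
Qed.

End universal_disposition_spaces.


(** * The Euclidean plane *)

Section euclidean_plane.
Context (R : realType).

Definition euclidean_norm_fun (x : 'rV[R]_2) : R :=
  Num.sqrt (x 0 0 ^+ 2 + x 0 1 ^+ 2).

Lemma euclidean_cauchy_schwarz (x y : 'rV[R]_2) :
  `|x 0 0 * y 0 0 + x 0 1 * y 0 1| <=
  euclidean_norm_fun x * euclidean_norm_fun y.
Proof.
rewrite -sqrtr_sqr -sqrtrM ?addr_ge0 ?sqr_ge0// ler_wsqrtr// -subr_ge0.
(* Lagrange's identity. *)
rewrite [leRHS](_ : _ = (x 0 0 * y 0 1 - x 0 1 * y 0 0) ^+ 2); last by ring.
exact: sqr_ge0.
Qed.

Lemma euclidean_normD (x y : 'rV[R]_2) :
  euclidean_norm_fun (x + y) <= euclidean_norm_fun x + euclidean_norm_fun y.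
Proof.
have xy := le_trans (ler_norm _) (euclidean_cauchy_schwarz x y).
rewrite -(ler_pXn2r (ltn0Sn 1)) ?nnegrE ?addr_ge0 ?sqrtr_ge0//.
rewrite sqrrD !sqr_sqrtr ?addr_ge0 ?sqr_ge0// !mxE.
move: xy; rewrite /euclidean_norm_fun; lra.
Qed.

Lemma euclidean_normZ k (x : 'rV[R]_2) :
  euclidean_norm_fun (k *: x) = `|k| * euclidean_norm_fun x.
Proof.
rewrite /euclidean_norm_fun !mxE !exprMn -mulrDr sqrtrM ?sqr_ge0//.
by rewrite sqrtr_sqr.
Qed.

Lemma euclidean_norm_coord (x : 'rV[R]_2) j : `|x 0 j| <= euclidean_norm_fun x.
Proof.
rewrite -sqrtr_sqr ler_wsqrtr//.
have [->|->] : j = 0 \/ j = 1.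
  by case: j => -[|[|//]] ?; [left|right]; exact: val_inj.
- by rewrite lerDl sqr_ge0.
- by rewrite lerDr sqr_ge0.
Qed.

Definition euclidean_norm : row_norm R 2 :=
  RowNorm _ _ _ euclidean_normD euclidean_normZ euclidean_norm_coord.

(** The rational parametrization, which misses only the point [(-1, 0)]. *)
Definition circle_point (t : R) : 'rV[R]_2 :=
  \row_j ((if j == 0 then 1 - t ^+ 2 else 2 * t) / (1 + t ^+ 2)).

Lemma euclidean_dotE (x y : 'rV[R]_2) :
  (x *m y^T) 0 0 = x 0 0 * y 0 0 + x 0 1 * y 0 1.
Proof.
rewrite mxE big_ord_recl big_ord1 !mxE.
by congr (_ + x 0 _ * y 0 _); exact: val_inj.
Qed.

(** The defect from [1] is half the squared distance of the two points; it
    vanishes only for [s = t]. *)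
Lemma circle_point_dot (s t : R) :
  (circle_point s *m (circle_point t)^T) 0 0 =
  1 - 2 * (s - t) ^+ 2 / ((1 + s ^+ 2) * (1 + t ^+ 2)).
Proof.
have s0 : 1 + s ^+ 2 != 0 by rewrite gt_eqF// ltr_pwDl// sqr_ge0.
have t0 : 1 + t ^+ 2 != 0 by rewrite gt_eqF// ltr_pwDl// sqr_ge0.
rewrite euclidean_dotE !mxE /=; field.
by rewrite s0 t0.
Qed.

Lemma circle_point_dot_lt1 (s t : R) : s != t ->
  (circle_point s *m (circle_point t)^T) 0 0 < 1.
Proof.
move=> st; rewrite circle_point_dot ltrBlDr ltrDl divr_gt0//.
  by rewrite mulr_gt0// lt_neqAle sqr_ge0 eq_sym sqrf_eq0 subr_eq0 st.
by rewrite mulr_gt0// ltr_pwDl// sqr_ge0.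
Qed.

Lemma circle_point_norm (t : R) : euclidean_norm (circle_point t) = 1.
Proof.
have := circle_point_dot t t.
rewrite subrr expr0n mulr0 mul0r subr0 euclidean_dotE -!expr2.
by rewrite /= /euclidean_norm_fun => ->; rewrite sqrtr1.
Qed.

Lemma circle_functional_bound (t : R) (a : 'rV[R]_2) :
  `|(a *m (circle_point t)^T) 0 0| <= euclidean_norm a.
Proof.
rewrite euclidean_dotE (le_trans (euclidean_cauchy_schwarz _ _))//.
by rewrite [X in _ * X]circle_point_norm mulr1.
Qed.

End euclidean_plane.

(** * Cardinality of dense sets *)

(** Points of [D] chosen within [e / 2] of the [x t] are pairwise distinct. *)
Lemma card_le_dense_separated (R : realType) (T : Type)
    (V : normedModType R) (e : R) (x : T -> V) (D : set V) :
  0 < e -> (forall s t, s <> t -> e <= `|x s - x t|) -> dense D ->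
  [set: T] #<= D.
Proof.
move=> e0 xe Dd.
have e20 : 0 < e / 2 by rewrite divr_gt0.
have near_x t : exists y, D y /\ `|x t - y| < e / 2.
  have [|y [ty Dy]] := Dd _ _ (ball_open (x t) (e / 2)).
    by exists (x t); exact: ballxx.
  by exists y; split=> //; move: ty; rewrite -ball_normE.
have [y yP] := choice near_x.
have yinj : {in [set: T] &, injective y}.
  move=> s t _ _ yst; apply: contrapT => /xe; apply/negP; rewrite -ltNge.
  have := (yP s).2; rewrite yst => xs; have xt := (yP t).2.
  rewrite (le_lt_trans (ler_distD (y t) _ _))// [ltRHS]splitr ltrD//.
  by rewrite distrC.
apply: (@card_le_trans _ _ _ [set y t | t in [set: T]]).
  by have /card_eqPle[] := inj_card_eq yinj.
by apply: subset_card_le => _ [t _ <-]; exact: (yP t).1.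
Qed.

Theorem corollary7p3 (R : realType) (G : completeNormedModType R)
  (hG : universal_disposition G) :
  [set: R] #<= density_character G.
Proof.
have [phi phi_iso] := universal_disposition_embeds R G hG _ (euclidean_norm R).
have [x xE] := choice (fun t => universal_disposition_point R G hG _ _
  phi phi_iso _ (circle_functional_bound R t)).
apply: (card_le_dense_separated R R G 1 x) => //; last first.
  exact: (density_characterP G).1.
move=> s t st.
apply: (separated_points _ _ _ _ _ _ _ (circle_point R s) _ _ (xE s) (xE t)).
- exact: circle_point_norm.
- by rewrite circle_point_dot subrr expr0n mulr0 mul0r subr0.
- by rewrite (le_trans (circle_functional_bound _ _ _))// circle_point_norm.
- by apply: circle_point_dot_lt1; exact/eqP.
Qed.
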